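(* Let $H$ be a two-qubit Hamiltonian, i.e. a $4\times4$ complex Hermitian matrix. Then $H$ is 3-non-universal (i.e. not 3-universal) if any of the following conditions holds: (1) $H$ is a local Hamiltonian; (2) $H$ has an eigenvector of the form $|a\rangle\otimes|a\rangle$ for some $|a\rangle\in\mathbb{C}^2$; (3) $\operatorname{Tr}(H)=0$; (4) $H=rI_4+(U\otimes U)A(U\otimes U)^\dagger$ for some $r\in\mathbb{R}$, some $U\in\mathrm{U}(2)$ and some antisymmetric $4\times 4$ Hermitian matrix $A$ (antisymmetric means $A^{\mathsf T}=-A$); (5) $[H,U\otimes U]=0$ for some $U\in\mathrm{U}(2)$ with distinct eigenvalues.
   Context: A two-qubit Hamiltonian is local if it equals $H_1\otimes I+I\otimes H_2$ for some $2\times2$ Hermitian matrices $H_1,H_2$, where $I$ is the $2\times2$ identity. $I_4$ is the $4\times4$ identity. Transposition is with respect to the standard basis. Let $\mathcal{S}_3\subset\mathrm{U}(8)$ be the group of the six matrices that permute the three tensor factors of $(\mathbb{C}^2)^{\otimes3}$. A two-qubit Hamiltonian $H$ is 3-universal if for every unitary $V\in\mathrm{U}(8)$ and every $\varepsilon>0$ there exist $l\in\mathbb{N}$, matrices $H_1,\dots,H_l\in\{P(H\otimes I)P^\dagger : P\in\mathcal{S}_3\}$ and times $t_1,\dots,t_l>0$ such that $\|V-e^{-iH_1t_1}\cdots e^{-iH_lt_l}\|_\infty<\varepsilon$, where $\|\cdot\|_\infty$ is the spectral (operator) norm. *)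

(* Defs.v *)
(* Complex matrices over R[i] for R : realType, with the Kronecker product *t of
   mathcomp.real_closed.mxtens. *)
From HB Require Import structures.
From mathcomp Require Import all_boot all_order all_algebra all_fingroup.
From mathcomp Require Import spectral.
From mathcomp Require Import boolp classical_sets functions reals.
From mathcomp Require Import topology normedtype sequences.
From mathcomp Require Import complex mxtens.

Set Implicit Arguments.
Unset Strict Implicit.
Unset Printing Implicit Defensive.

Import Order.TTheory GRing.Theory Num.Theory.
Import numFieldNormedType.Exports.
Local Open Scope classical_set_scope.
Local Open Scope ring_scope.
Local Open Scope complex_scope.
Local Open Scope sesquilinear_scope.

(* The limit is taken in the topology of 'M[C]_n, i.e. entrywise.  C is kept
   abstract because the topology of a numFieldType is not found by inference
   on the concrete type R[i]. *)
Definition expmx (C : numFieldType) (n : nat) (A : 'M[C]_n) : 'M[C]_n :=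
  limn (series (fun k : nat => (k`!%:R)^-1 *: A ^+ k)).

Section ComplexMatrices.
Variable R : realType.
Local Notation C := R[i].

Definition vnorm n (v : 'cV[C]_n) : R :=
  Num.sqrt (\sum_(i < n) Normc.normc (v i 0) ^+ 2).

Definition specnorm n (A : 'M[C]_n) : R :=
  sup [set vnorm (A *m v) | v in [set v : 'cV[C]_n | vnorm v = 1]].

(* Column eigenvectors; mathcomp's eigenspace consists of row vectors. *)
Definition eigenvector n (A : 'M[C]_n) (v : 'cV[C]_n) : Prop :=
  v != 0 /\ exists a : C, A *m v = a *: v.

(* The eigenvalues of mathcomp are those of row vectors, which are the same
   as those of column vectors. *)
Definition distinct_eigenvalues (U : 'M[C]_2) : Prop :=
  exists a b : C, [/\ a != b, eigenvalue U a & eigenvalue U b].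

Definition local_hamiltonian (H : 'M[C]_(2 * 2)) : Prop :=
  exists H1 H2 : 'M[C]_2, [/\ H1 \is hermsymmx, H2 \is hermsymmx
    & H = H1 *t 1%:M + 1%:M *t H2].

(* The bits (b0, b1, b2) of the standard basis vector e_b0 *t e_b1 *t e_b2
   with index i. *)
Definition qubits (i : 'I_(2 * 2 * 2)) : 3.-tuple 'I_2 :=
  let: (i01, i2) := mxtens_unindex i in
  let: (i0, i1) := mxtens_unindex i01 in [tuple i0; i1; i2].

(* Maps the basis vector of bits b to that of bits b \o s, hence v0 *t v1 *t v2
   to v_(s 0) *t v_(s 1) *t v_(s 2). *)
Definition factor_perm (s : 'S_3) : 'M[C]_(2 * 2 * 2) :=
  \matrix_(i, j) [forall k, tnth (qubits i) k == tnth (qubits j) (s k)]%:R.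

Definition three_qubit_hamiltonians (H : 'M[C]_(2 * 2)) :
    set 'M[C]_(2 * 2 * 2) :=
  [set factor_perm s *m (H *t (1%:M : 'M[C]_2)) *m (factor_perm s)^t*
     | s in [set: 'S_3]].

Definition three_universal (H : 'M[C]_(2 * 2)) : Prop :=
  forall (V : 'M[C]_(2 * 2 * 2)) (eps : R), V \is unitarymx -> 0 < eps ->
  exists (l : nat) (Hs : 'I_l -> 'M[C]_(2 * 2 * 2)) (t : 'I_l -> R),
    [/\ forall j, three_qubit_hamiltonians H (Hs j),
        forall j, 0 < t j
      & specnorm (V - \prod_(j < l) expmx ((- 'i * (t j)%:C) *: Hs j)) < eps].

End ComplexMatrices.

(* Main.v *)
(* Each condition yields a closed polynomial condition on X in U(8) that holds
   for the identity, is stable under products, holds for every exp(-itH_j), and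
   fails for some unitary:
   (1) X is a product A *t B *t C, so that
       X_000,000 X_110,110 = X_100,100 X_010,010;
   (2), (5) X commutes with m *t m *t m, where m is the projection a a^* (up to
       scaling) resp. U; these are not scalar matrices, but only scalar
       matrices commute with all unitaries;
   (3) det X = 1;
   (4) X = c W O W^* with W = U *t U *t U, c a phase and O real orthogonal, so
       that Y := W^* X W satisfies Y Y^T = c^2.
   Exponentials are computed in a unitary eigenbasis, where convergence of the
   series reduces to that of cosine and sine. *)
Require Import Defs.
From HB Require Import structures.
From mathcomp Require Import all_boot all_order all_algebra all_fingroup.
From mathcomp Require Import spectral.
From mathcomp Require Import boolp classical_sets functions reals.
From mathcomp Require Import topology normedtype sequences.
From mathcomp Require Import complex mxtens.
From mathcomp Require Import trigo ring lra.

Set Implicit Arguments.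
Unset Strict Implicit.
Unset Printing Implicit Defensive.

Import Order.TTheory GRing.Theory Num.Theory.
Import numFieldNormedType.Exports.
Local Open Scope ring_scope.
Local Open Scope complex_scope.
Local Open Scope sesquilinear_scope.

(** * Exponential of a diagonalizable matrix *)

Lemma mx_cvg (K : numFieldType) (T : Type) (F : set_system T) m n
    (f : T -> 'M[K]_(m, n)) (l : 'M[K]_(m, n)) :
  Filter F -> (forall i j, ((fun x => f x i j) @ F --> l i j)%classic) ->
  (f @ F --> l)%classic.
Proof.
move=> FF fl A [P lP PA]; near=> x; apply: PA => i j.
move: i j; near: x.
apply: filter_forall => i; apply: filter_forall => j.
exact: fl (lP i j).
Unshelve. all: by end_near. Qed.

Lemma continuous_sumr (K : numFieldType) (T : topologicalType) (I : Type)
    (r : seq I) (P : pred I) (f : I -> T -> K) :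
  (forall i, P i -> continuous (f i)) ->
  continuous (fun x => \sum_(i <- r | P i) f i x).
Proof. by apply: continuous_big; apply: add_continuous. Qed.

Lemma continuous_prodr (K : numFieldType) (T : topologicalType) (I : Type)
    (r : seq I) (P : pred I) (f : I -> T -> K) :
  (forall i, P i -> continuous (f i)) ->
  continuous (fun x => \prod_(i <- r | P i) f i x).
Proof. by apply: continuous_big; apply: mul_continuous. Qed.

Lemma exprmx_diag (K : comPzRingType) n (P Q : 'M[K]_n) (d : 'rV[K]_n) k :
  Q *m P = 1%:M -> P *m Q = 1%:M ->
  (Q *m diag_mx d *m P) ^+ k = Q *m diag_mx (\row_j d 0 j ^+ k) *m P.
Proof.
move=> QP PQ; elim: k => [|k IH].
  rewrite expr0 (_ : diag_mx _ = 1%:M) ?mulmx1 ?QP//.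
  by apply/matrixP => i j; rewrite !mxE expr0.
rewrite exprS IH -mulmxE !mulmxA -[_ *m P *m Q]mulmxA PQ mulmx1.
congr (_ *m _); rewrite -!mulmxA; congr (_ *m _).
apply/matrixP => i j; rewrite mul_diag_mx !mxE exprS.
by case: eqP => [->|]; rewrite ?mulr1n ?mulr0n ?mulr0.
Qed.

(** Each entry of a partial sum is a fixed finite linear combination, with coefficients
    [Q i l * P l j], of the scalar partial sums at the diagonal entries, so matrix convergence
    follows from scalar convergence. *)
Lemma expmx_diag (K : numFieldType) n (P Q : 'M[K]_n) (d e : 'rV[K]_n) :
  Q *m P = 1%:M -> P *m Q = 1%:M ->
  (forall j, (series (fun k => (k`!%:R)^-1 * d 0 j ^+ k) @ \oo --> e 0 j)%classic) ->
  expmx (Q *m diag_mx d *m P) = Q *m diag_mx e *m P.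
Proof.
move=> QP PQ de; apply: cvg_lim; first exact: norm_hausdorff.
apply: mx_cvg => i j.
have -> : (fun x => series (fun k => k`!%:R^-1 *:
      (Q *m diag_mx d *m P) ^+ k) x i j) =
    (fun x => \sum_l Q i l * P l j *
       series (fun k => (k`!%:R)^-1 * d 0 l ^+ k) x).
  apply/funext => x; rewrite /series /= summxE.
  under [RHS]eq_bigr do rewrite mulr_sumr.
  rewrite exchange_big /=; apply: eq_bigr => k _.
  rewrite exprmx_diag// !mxE mulr_sumr; apply: eq_bigr => l _.
  by rewrite mul_mx_diag !mxE; ring.
have -> : (Q *m diag_mx e *m P) i j = \sum_l Q i l * P l j * e 0 l.
  by rewrite mxE; apply: eq_bigr => l _; rewrite mul_mx_diag !mxE; ring.
apply: cvg_big => [|l _]; first exact: add_continuous.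
by apply: cvgM; [exact: cvg_cst|exact: de].
Qed.

(** The hypothesis mentions no topology, so over [R[i]] it can be checked by inequalities between
    real numbers. *)
Lemma cvgn_eventually (K : numFieldType) (u : nat -> K) (l : K) :
  (forall e, 0 < e -> exists N, forall n, (N <= n)%N -> `|l - u n| < e) ->
  (u @ \oo --> l)%classic.
Proof.
move=> ul; apply/cvgrPdist_lt => e /ul[N Nu].
by exists N => // n /= /Nu.
Qed.

(** * The phases $e^{ix}$ and their power series *)

Section Cis.
Variable R : realType.

Definition cis (x : R) : R[i] := cos x +i* sin x.

Lemma cis0 : cis 0 = 1.
Proof. by rewrite /cis cos0 sin0. Qed.

Lemma cisD x y : cis (x + y) = cis x * cis y.
Proof. by rewrite /cis cosD sinD; simpc; congr (_ +i* _); ring. Qed.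

Lemma conj_cis x : Num.conj (cis x) = cis (- x).
Proof. by rewrite /cis cosN sinN. Qed.

Lemma cis_sum (I : finType) (f : I -> R) :
  \prod_i cis (f i) = cis (\sum_i f i).
Proof. by elim/big_rec2: _ => [|i x y _ ->]; rewrite ?cis0 ?cisD. Qed.

Lemma cisK x : cis x * cis (- x) = 1.
Proof. by rewrite -cisD subrr cis0. Qed.

Lemma normc_le (z : R[i]) : Normc.normc z <= `|complex.Re z| + `|complex.Im z|.
Proof.
case: z => a b /=.
rewrite -[leRHS]ger0_norm ?addr_ge0// -sqrtr_sqr ler_wsqrtr//.
rewrite sqrrD !real_normK ?num_real// lerD2r lerDl.
by rewrite mulrn_wge0// mulr_ge0.
Qed.

Lemma cis_coeff (x : R) k :
  (k`!%:R)^-1 * ('i * x%:C) ^+ k = cos_coeff x k +i* sin_coeff x k.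
Proof.
rewrite /cos_coeff /sin_coeff /= exprMn -rmorphXn /=.
have -> : (k`!%:R : R[i])^-1 = ((k`!%:R : R)^-1)%:C by rewrite fmorphV rmorph_nat.
(* Powers of $i$ are real for even [k] and imaginary for odd [k]; the two sign exponents are those
   of [cos_coeff] and [sin_coeff]. *)
have -> : ('i : R[i]) ^+ k =
    ((~~ odd k)%:R * (-1) ^ k./2) +i* ((odd k)%:R * (-1) ^+ k.-1./2).
  rewrite -[in LHS](odd_double_half k) exprD -mul2n exprM sqr_i.
  have -> : (-1 : R[i]) ^+ k./2 = ((-1) ^+ k./2)%:C.
    by rewrite rmorphXn rmorphN1.
  case: (boolP (odd k)) => ko /=.
    have -> : k.-1./2 = k./2 by case: k ko => //= k ko; rewrite uphalf_half (negbTE ko).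
    by rewrite expr1; simpc.
  by rewrite expr0; simpc.
by simpc; congr (_ +i* _); ring.
Qed.

Lemma Re_sum (I : Type) (r : seq I) (P : pred I) (f : I -> R[i]) :
  complex.Re (\sum_(i <- r | P i) f i) = \sum_(i <- r | P i) complex.Re (f i).
Proof. by elim/big_rec2: _ => // i y z _ <-; case: (f i); case: z. Qed.

Lemma Im_sum (I : Type) (r : seq I) (P : pred I) (f : I -> R[i]) :
  complex.Im (\sum_(i <- r | P i) f i) = \sum_(i <- r | P i) complex.Im (f i).
Proof. by elim/big_rec2: _ => // i y z _ <-; case: (f i); case: z. Qed.

Lemma cis_series (x : R) (e : R[i]) : 0 < e -> exists N, forall n, (N <= n)%N ->
  `|cis x - series (fun k => (k`!%:R)^-1 * ('i * x%:C) ^+ k) n| < e.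
Proof.
(* Positivity in [R[i]] forces the imaginary part to vanish, so the tolerance is real; half of it
   goes to the cosine and half to the sine. *)
case: e => e e'; rewrite ltcE /= => /andP[/eqP -> e0].
have e2 : 0 < e / 2 by lra.
have : (series (cos_coeff x) @ \oo --> cos x)%classic.
  by rewrite unlock; exact: is_cvg_series_cos_coeff.
move=> /cvgrPdist_lt /(_ _ e2) [N _ Nc].
have : (series (sin_coeff x) @ \oo --> sin x)%classic.
  by rewrite unlock; exact: is_cvg_series_sin_coeff.
move=> /cvgrPdist_lt /(_ _ e2) [M _ Ms].
exists (maxn N M) => n; rewrite geq_max => /andP[/Nc /= cn /Ms /= sn].
rewrite -[`|_|]/((Normc.normc _)%:C) complexr0 ltcR.
apply: le_lt_trans (normc_le _) _.
rewrite /series /=.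
under eq_bigr do rewrite cis_coeff.
have -> (z w : R[i]) : complex.Re (z - w) = complex.Re z - complex.Re w by case: z w => ? ? [].
have -> (z w : R[i]) : complex.Im (z - w) = complex.Im z - complex.Im w by case: z w => ? ? [].
rewrite Re_sum Im_sum /=.
by rewrite /series /= in cn sn; lra.
Qed.
End Cis.

(** * Unitary, Hermitian and diagonal matrices *)

Section DiagonalMatrices.
Variable K : comPzRingType.

Definition dg n (z : 'I_n -> K) : 'M[K]_n := diag_mx (\row_j z j).

Lemma dgM n (y z : 'I_n -> K) : dg y *m dg z = dg (fun j => y j * z j).
Proof.
apply/matrixP => i j; rewrite mul_diag_mx !mxE.
by case: eqP => [->|]; rewrite ?mulr1n ?mulr0n ?mulr0.
Qed.

Lemma dgD n (y z : 'I_n -> K) : dg y + dg z = dg (fun j => y j + z j).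
Proof. by apply/matrixP => i j; rewrite !mxE mulrnDl. Qed.

Lemma dg_const n (c : K) : dg (fun _ : 'I_n => c) = c%:M.
Proof. by apply/matrixP => i j; rewrite !mxE. Qed.

Lemma eq_dg n (y z : 'I_n -> K) : y =1 z -> dg y = dg z.
Proof. by move=> yz; congr diag_mx; apply/rowP => j; rewrite !mxE. Qed.

Lemma tr_dg n (z : 'I_n -> K) : (dg z)^T = dg z.
Proof. exact: tr_diag_mx. Qed.

Lemma scale_dg n (c : K) (z : 'I_n -> K) : c *: dg z = dg (fun j => c * z j).
Proof. by apply/matrixP => i j; rewrite !mxE mulrnAr. Qed.

Lemma tens_dg m n (y : 'I_m -> K) (z : 'I_n -> K) : dg y *t dg z =
  dg (fun k => y (mxtens_unindex k).1 * z (mxtens_unindex k).2).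
Proof.
apply/matrixP => i j; case: (mxtens_indexP i) => i1 i2.
case: (mxtens_indexP j) => j1 j2.
rewrite tensmxE !mxE mxtens_indexK /= (can_eq (@mxtens_indexK _ _)) xpair_eqE.
by case: (i1 == j1); case: (i2 == j2);
  rewrite ?(mulr0n, mulr1n) ?(mulr0, mul0r) ?mulr1n.
Qed.

Lemma tens11 m n : (1%:M : 'M[K]_m) *t (1%:M : 'M[K]_n) = 1%:M.
Proof. by rewrite -!dg_const tens_dg mulr1 dg_const. Qed.

Lemma det_dg n (z : 'I_n -> K) : \det (dg z) = \prod_j z j.
Proof. by rewrite det_diag; apply: eq_bigr => j _; rewrite mxE. Qed.

Lemma trace_dg n (z : 'I_n -> K) : \tr (dg z) = \sum_j z j.
Proof. by rewrite mxtrace_diag; apply: eq_bigr => j _; rewrite mxE. Qed.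

End DiagonalMatrices.

(** Entry $(i,j)$ of the commutation forces [N i j = 0] or [d i = d j]. The first hypothesis says
    that [e] is a function of [d], so this is commutation with a function of a diagonal matrix. *)
Lemma dg_comm (K : idomainType) n (d e : 'I_n -> K) (N : 'M[K]_n) :
  (forall i j, d i = d j -> e i = e j) ->
  dg d *m N = N *m dg d -> dg e *m N = N *m dg e.
Proof.
move=> de /matrixP dN; apply/matrixP => i j; have := dN i j.
rewrite !mul_diag_mx !mul_mx_diag !mxE => /eqP.
rewrite [eqbRHS]mulrC -subr_eq0 -mulrBl mulf_eq0 subr_eq0.
move=> /orP[/eqP/de->|/eqP->]; first by rewrite mulrC.
by rewrite mulr0 mul0r.
Qed.

Lemma similar_dg_comm (K : idomainType) n (P Q M : 'M[K]_n) (d e : 'I_n -> K) :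
  P *m Q = 1%:M -> (forall i j, d i = d j -> e i = e j) ->
  Q *m dg d *m P *m M = M *m (Q *m dg d *m P) ->
  Q *m dg e *m P *m M = M *m (Q *m dg e *m P).
Proof.
move=> PQ de dM; have QP := mulmx1C PQ.
set N := P *m M *m Q.
have MN : M = Q *m N *m P by rewrite /N !mulmxA QP mul1mx -mulmxA QP mulmx1.
have {}dM : dg d *m N = N *m dg d.
  have := congr1 (fun X => P *m X *m Q) dM.
  by rewrite /N !mulmxA PQ mul1mx => ->; rewrite -!mulmxA PQ mulmx1.
clearbody N; rewrite {}MN.
have PK (X : 'M[K]_n) : X *m P *m Q = X by rewrite -mulmxA PQ mulmx1.
by rewrite !mulmxA !PK -[Q *m dg _ *m N]mulmxA (dg_comm de dM) mulmxA.
Qed.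

Section Adjoint.
Variable C : numClosedFieldType.

Lemma conj_dg n (z : 'I_n -> C) :
  map_mx Num.conj (dg z) = dg (fun j => Num.conj (z j)).
Proof. by apply/matrixP => i j; rewrite !mxE rmorphMn. Qed.

Lemma adjmxM m n p (A : 'M[C]_(m, n)) (B : 'M[C]_(n, p)) :
  (A *m B)^t* = B^t* *m A^t*.
Proof. by rewrite trmx_mul map_mxM. Qed.

Lemma adjmx_tens m n p q (A : 'M[C]_(m, n)) (B : 'M[C]_(p, q)) :
  (A *t B)^t* = A^t* *t B^t*.
Proof. by rewrite trmx_tens map_mxT. Qed.

Lemma unitarymxPV n (P : 'M[C]_n) : P \is unitarymx -> P^t* *m P = 1%:M.
Proof. by move=> /unitarymxP/mulmx1C. Qed.

Lemma dg_unitary n (z : 'I_n -> C) :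
  (forall j, z j * Num.conj (z j) = 1) -> dg z \is unitarymx.
Proof.
move=> z1; apply/unitarymxP; rewrite tr_dg conj_dg dgM -dg_const.
exact: eq_dg.
Qed.

Lemma tens_unitary m n (P : 'M[C]_m) (Q : 'M[C]_n) :
  P \is unitarymx -> Q \is unitarymx -> P *t Q \is unitarymx.
Proof.
move=> /unitarymxP PK /unitarymxP QK; apply/unitarymxP.
by rewrite adjmx_tens tensmx_mul PK QK tens11.
Qed.

Lemma tens_conjmx m n (P X : 'M[C]_m) (Q Y : 'M[C]_n) :
  (P^t* *m X *m P) *t (Q^t* *m Y *m Q) = (P *t Q)^t* *m (X *t Y) *m (P *t Q).
Proof. by rewrite adjmx_tens !tensmx_mul. Qed.

Lemma conjmxM n (P Q X : 'M[C]_n) :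
  Q *m (P^t* *m X *m P) *m Q^t* = (P *m Q^t*)^t* *m X *m (P *m Q^t*).
Proof. by rewrite adjmxM trmxCK !mulmxA. Qed.

Lemma mul_unitarymx_adj n (P Q : 'M[C]_n) :
  P \is unitarymx -> Q \is unitarymx -> P *m Q^t* \is unitarymx.
Proof. by move=> Pu Qu; rewrite mul_unitarymx// trmxC_unitary. Qed.

Lemma tens_conjmx1 m n (P X : 'M[C]_m) (Q : 'M[C]_n) : Q \is unitarymx ->
  (P^t* *m X *m P) *t 1%:M = (P *t Q)^t* *m (X *t 1%:M) *m (P *t Q).
Proof. by move=> Qu; rewrite -tens_conjmx mulmx1 (unitarymxPV Qu). Qed.

Lemma tens_1conjmx m n (P : 'M[C]_m) (Q X : 'M[C]_n) : P \is unitarymx ->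
  1%:M *t (Q^t* *m X *m Q) = (P *t Q)^t* *m (1%:M *t X) *m (P *t Q).
Proof. by move=> Pu; rewrite -tens_conjmx mulmx1 (unitarymxPV Pu). Qed.

Lemma scale_conjmx n (c : C) (P X : 'M[C]_n) :
  c *: (P^t* *m X *m P) = P^t* *m (c *: X) *m P.
Proof. by rewrite -scalemxAr -scalemxAl. Qed.

Lemma scalar_add_conjmx n (c : C) (P X : 'M[C]_n) : P \is unitarymx ->
  c%:M + P^t* *m X *m P = P^t* *m (c%:M + X) *m P.
Proof.
move=> Pu; rewrite mulmxDr mulmxDl mul_mx_scalar -scalemxAl (unitarymxPV Pu).
by rewrite scalemx1.
Qed.

Lemma unitary_conjmx n (P X : 'M[C]_n) : P \is unitarymx -> X \is unitarymx ->
  P^t* *m X *m P \is unitarymx.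
Proof. by move=> Pu Xu; rewrite !mul_unitarymx// trmxC_unitary. Qed.

Lemma unitary_mxconj n (P X : 'M[C]_n) : P \is unitarymx -> X \is unitarymx ->
  P *m X *m P^t* \is unitarymx.
Proof. by move=> Pu Xu; rewrite !mul_unitarymx// trmxC_unitary. Qed.

Lemma hermsymmxP n (A : 'M[C]_n) : reflect (A^t* = A) (A \is hermsymmx).
Proof. by apply: (iffP (is_hermitianmxP _ _ _)); rewrite expr0 scale1r => AE. Qed.

Lemma hermitian_conj n (A Q : 'M[C]_n) :
  A \is hermsymmx -> Q *m A *m Q^t* \is hermsymmx.
Proof.
by move=> /hermsymmxP AE; apply/hermsymmxP; rewrite !adjmxM trmxCK AE mulmxA.
Qed.

Lemma hermitian_tens m n (A : 'M[C]_m) (B : 'M[C]_n) :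
  A \is hermsymmx -> B \is hermsymmx -> A *t B \is hermsymmx.
Proof.
move=> /hermsymmxP AE /hermsymmxP BE.
by apply/hermsymmxP; rewrite adjmx_tens AE BE.
Qed.

Lemma hermitian1 n : (1%:M : 'M[C]_n) \is hermsymmx.
Proof. by apply/hermsymmxP; rewrite trmx1 map_mx1. Qed.

Lemma hermitian_diagonalization n (A : 'M[C]_n) : A \is hermsymmx ->
  exists (P : 'M[C]_n) (z : 'I_n -> C),
    [/\ P \is unitarymx, forall j, z j \is Num.real & A = P^t* *m dg z *m P].
Proof.
move=> hA; exists (spectralmx A), (spectral_diag A 0).
have sU := spectral_unitarymx A; split=> //.
- by move=> j; exact: (mxOverP (hermitian_spectral_diag_real hA)).
- rewrite {1}(orthomx_spectralP (hermitian_normalmx hA)) (invmx_unitary sU).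
  by congr (_ *m diag_mx _ *m _); apply/rowP => j; rewrite mxE.
Qed.

(** Transposing $P^*DP$ gives $P^TD\bar P$, so antisymmetry yields a second diagonalization of the
    same matrix: conjugate basis, negated eigenvalues. *)
Lemma antisymmetric_conj n (A P : 'M[C]_n) (z : 'I_n -> C) :
  A = P^t* *m dg z *m P -> A^T = - A ->
  A = (map_mx Num.conj P)^t* *m dg (fun j => - z j) *m map_mx Num.conj P.
Proof.
move=> AE AT.
have QT : (map_mx Num.conj P)^t* = P^T.
  by rewrite map_trmx -map_mx_comp map_mx_id//; exact: conjCK.
rewrite -[LHS]opprK -AT AE !trmx_mul tr_dg QT -map_trmx trmxK mulmxA.
rewrite -mulNmx -mulmxN; congr (_ *m _ *m _).
by apply/matrixP => i j; rewrite !mxE mulNrn.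
Qed.

Lemma map_conj_conjmx n (P X : 'M[C]_n) : map_mx Num.conj (P^t* *m X *m P) =
  (map_mx Num.conj P)^t* *m map_mx Num.conj X *m map_mx Num.conj P.
Proof.
rewrite !map_mxM; congr (_ *m _ *m _).
by apply/matrixP => i j; rewrite !mxE.
Qed.

Lemma det_conjmx n (P X : 'M[C]_n) : P \is unitarymx ->
  \det (P^t* *m X *m P) = \det X.
Proof.
move=> Pu; rewrite !det_mulmx mulrC mulrA -det_mulmx.
by move/unitarymxP: Pu => ->; rewrite det1 mul1r.
Qed.

Lemma trace_conjmx n (P X : 'M[C]_n) : P \is unitarymx ->
  \tr (P^t* *m X *m P) = \tr X.
Proof.
by move=> /unitarymxP PK; rewrite mxtrace_mulC mulmxA PK mul1mx.
Qed.

End Adjoint.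

(** * One-parameter groups of Hermitian matrices *)

Section ExpIt.
Variable R : realType.
Local Notation C := R[i].

Definition exp_it (t : R) n (A : 'M[C]_n) := expmx ((- 'i * t%:C) *: A).

Lemma exp_it_dg t n (P : 'M[C]_n) (d : 'I_n -> R) : P \is unitarymx ->
  exp_it t (P^t* *m dg (fun j => (d j)%:C) *m P) =
  P^t* *m dg (fun j => cis (- (t * d j))) *m P.
Proof.
move=> Pu; rewrite /exp_it scalemxAl scalemxAr scale_dg.
rewrite (eq_dg (z := fun j => 'i * (- (t * d j))%:C)); last first.
  by move=> j /=; rewrite rmorphN rmorphM mulrN mulrA !mulNr.
apply: expmx_diag => [||j]; [exact: unitarymxPV|exact/unitarymxP|].
rewrite !mxE; apply: cvgn_eventually => e e0.
exact: cis_series.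
Qed.

(** Case analysis on this view replaces a Hermitian matrix and its exponential at once, by diagonal
    forms in one common unitary basis with real [d]. *)
Variant exp_it_spec t n : 'M[C]_n -> 'M[C]_n -> Prop :=
  ExpItSpec (P : 'M[C]_n) (d : 'I_n -> R) of P \is unitarymx :
  exp_it_spec t (P^t* *m dg (fun j => (d j)%:C) *m P)
    (P^t* *m dg (fun j => cis (- (t * d j))) *m P).

Lemma exp_itP t n (A : 'M[C]_n) : A \is hermsymmx -> exp_it_spec t A (exp_it t A).
Proof.
move=> /hermitian_diagonalization[P [z [Pu zR ->]]].
have -> : dg z = dg (fun j => (complex.Re (z j))%:C).
  by apply: eq_dg => j; rewrite RRe_real.
rewrite exp_it_dg; last exact: Pu.
exact: ExpItSpec.
Qed.

(** The phase [cis (- (t * d j))] depends on [j] only through [d j], so [similar_dg_comm] applies in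
    the eigenbasis. *)
Lemma exp_it_comm t n (A M : 'M[C]_n) : A \is hermsymmx ->
  A *m M = M *m A -> exp_it t A *m M = M *m exp_it t A.
Proof.
move=> /(exp_itP t)[P d /unitarymxP PK]; apply: similar_dg_comm PK _.
by move=> i j [->].
Qed.

Lemma exp_it_unitary t n (A : 'M[C]_n) : A \is hermsymmx ->
  exp_it t A \is unitarymx.
Proof.
move=> /(exp_itP t)[P d Pu].
apply: (unitary_conjmx Pu).
by apply: dg_unitary => j; rewrite conj_cis cisK.
Qed.

Lemma exp_it_conj t n (A Q : 'M[C]_n) : A \is hermsymmx -> Q \is unitarymx ->
  exp_it t (Q *m A *m Q^t*) = Q *m exp_it t A *m Q^t*.
Proof.
move=> /(exp_itP t)[P d Pu] Qu; 
apply: etrans (congr1 (exp_it t (n := n)) (conjmxM P Q _)) _.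
apply: etrans (exp_it_dg _ _ (mul_unitarymx_adj Pu Qu)) _.
exact: esym (conjmxM _ _ _).
Qed.

(** The determinant is the product of the phases, that is, the phase of $-t\operatorname{Tr}A$. *)
Lemma det_exp_it t n (A : 'M[C]_n) : A \is hermsymmx -> \tr A = 0 ->
  \det (exp_it t A) = 1.
Proof.
move=> /(exp_itP t)[P d Pu].
rewrite (trace_conjmx _ Pu) (det_conjmx _ Pu) trace_dg det_dg cis_sum.
rewrite -rmorph_sum sumrN -mulr_sumr => /eqP; rewrite fmorph_eq0 => /eqP ->.
by rewrite mulr0 oppr0 cis0.
Qed.

(** The basis [P *t Q] diagonalizes both summands; the eigenvalues add, and [cis] turns the sums
    into products. *)
Lemma exp_it_tens t m n (A : 'M[C]_m) (B : 'M[C]_n) :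
  A \is hermsymmx -> B \is hermsymmx ->
  exp_it t (A *t 1%:M + 1%:M *t B) = exp_it t A *t exp_it t B.
Proof.
move=> /(exp_itP t)[P d Pu] /(exp_itP t)[Q e Qu].
rewrite (tens_conjmx1 _ _ Qu) (tens_1conjmx _ _ Pu) tens_conjmx.
rewrite -mulmxDl -mulmxDr -!dg_const !tens_dg dgD.
rewrite (eq_dg (z := fun k : 'I_(m * n) =>
  (d (mxtens_unindex k).1 + e (mxtens_unindex k).2)%:C)); last first.
  by move=> k; rewrite mulr1 mul1r rmorphD.
rewrite exp_it_dg; last exact: tens_unitary.
congr (_ *m _ *m _); apply: eq_dg => k.
by rewrite mulrDr opprD cisD.
Qed.

Lemma exp_it_shift t n (A : 'M[C]_n) (r : R) : A \is hermsymmx ->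
  exp_it t ((r%:C)%:M + A) = cis (- (t * r)) *: exp_it t A.
Proof.
move=> /(exp_itP t)[P d Pu].
rewrite (scalar_add_conjmx _ _ Pu) -dg_const dgD.
rewrite (eq_dg (y := fun j => r%:C + (d j)%:C)
  (z := fun j => (r + d j)%:C)); last first.
  by move=> j; rewrite rmorphD.
apply: etrans (exp_it_dg _ _ Pu) (etrans _ (esym (scale_conjmx _ _ _))).
rewrite scale_dg; congr (_ *m _ *m _).
by apply: eq_dg => j; rewrite mulrDr opprD cisD.
Qed.

(* A Hermitian antisymmetric A is purely imaginary, so -itA is real. *)
Lemma exp_it_antisymmetric t n (A : 'M[C]_n) : A \is hermsymmx -> A^T = - A ->
  map_mx Num.conj (exp_it t A) = exp_it t A.
Proof.
move=> /hermitian_diagonalization[P [z [Pu zR AE]]] AT.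
have zE j : z j = (complex.Re (z j))%:C by rewrite RRe_real.
rewrite (eq_dg zE) in AE; have AQ := antisymmetric_conj AE AT.
have Qu : map_mx Num.conj P \is unitarymx by rewrite conjC_unitary.
apply: etrans (congr1 (map_mx Num.conj \o exp_it t (n := n)) AE) _.
apply: etrans (congr1 (map_mx Num.conj) (exp_it_dg t _ Pu)) _.
(* The right side is computed in the conjugate eigenbasis, where the negated eigenvalues account for
   the conjugation of the phases on the left. *)
rewrite [RHS](congr1 (exp_it t (n := n)) AQ).
rewrite (eq_dg (y := fun j => - (complex.Re (z j))%:C)
  (z := fun j => (- complex.Re (z j))%:C)); last first.
  by move=> j; rewrite rmorphN.
apply: etrans (map_conj_conjmx _ _) (etrans _ (esym (exp_it_dg t _ Qu))).
rewrite conj_dg; congr (_ *m _ *m _).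
by apply: eq_dg => j; rewrite conj_cis mulrN opprK.
Qed.

End ExpIt.

(** * Polynomial conditions and limits in the spectral norm *)

Lemma continuous_mulr (K : numFieldType) (T : topologicalType) (f g : T -> K) :
  continuous f -> continuous g -> continuous (fun x => f x * g x).
Proof. by move=> cf cg x; apply: cvgM; [exact: cf|exact: cg]. Qed.

Lemma continuous_addr (K : numFieldType) (T : topologicalType) (f g : T -> K) :
  continuous f -> continuous g -> continuous (fun x => f x + g x).
Proof. by move=> cf cg x; apply: cvgD; [exact: cf|exact: cg]. Qed.

Lemma continuous_oppr (K : numFieldType) (T : topologicalType) (f : T -> K) :
  continuous f -> continuous (fun x => - f x).
Proof. by move=> cf x; apply: cvgN; exact: cf. Qed.

Lemma continuous_det (K : numFieldType) n :
  continuous (fun X : 'M[K]_n => \det X).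
Proof.
apply: continuous_sumr => s _.
apply: continuous_mulr; first exact: cst_continuous.
apply: continuous_prodr => i _; exact: coord_continuous.
Qed.

Lemma continuous_mulmx (K : numFieldType) (T : topologicalType) p q r
    (f : T -> 'M[K]_(p, q)) (g : T -> 'M[K]_(q, r)) :
  (forall i j, continuous (fun x => f x i j)) ->
  (forall i j, continuous (fun x => g x i j)) ->
  forall i j, continuous (fun x => (f x *m g x) i j).
Proof.
move=> cf cg i j; under eq_fun do rewrite mxE.
by apply: continuous_sumr => k _; apply: continuous_mulr.
Qed.

(** If [f V] were nonzero, continuity would give a ball around [V] on which [f] differs from [f V]
    by less than its modulus and so cannot vanish. Approximation is entrywise, which is what a
    spectral norm bound delivers. *)
Lemma zero_at_limit (K : numFieldType) n (G : 'M[K]_n -> Prop)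
    (f : 'M[K]_n -> K) (V : 'M[K]_n) :
  continuous f -> (forall X, G X -> f X = 0) ->
  (forall e, 0 < e -> exists X, G X /\ forall i j, `|V i j - X i j| < e) ->
  f V = 0.
Proof.
move=> cf Gf VG; apply/eqP/negPn/negP => fV0.
have /cvgrPdist_lt /(_ _ (_ : 0 < `|f V|)) := cf V.
rewrite normr_gt0 => /(_ fV0) /nbhs_ballP[d /= d0 dV].
have [X [GX XV]] := VG _ d0.
have /dV /= : ball V d X by split=> // i j; exact: XV.
by rewrite (Gf _ GX) subr0 ltxx.
Qed.

Section SpectralNorm.
Variable R : realType.
Local Notation C := R[i].

Lemma normc_ge0 (z : C) : 0 <= Normc.normc z.
Proof. by case: z => a b; exact: sqrtr_ge0. Qed.

Lemma entry_le_vnorm n (v : 'cV[C]_n) i : Normc.normc (v i 0) <= vnorm v.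
Proof.
rewrite -[leLHS]ger0_norm ?normc_ge0// -sqrtr_sqr ler_wsqrtr//.
by rewrite (bigD1 i)//= lerDl sumr_ge0// => j _; rewrite sqr_ge0.
Qed.

Lemma normc_sum (I : Type) (r : seq I) (f : I -> C) :
  Normc.normc (\sum_(i <- r) f i) <= \sum_(i <- r) Normc.normc (f i).
Proof.
elim/big_ind2: _ => [|x z y w zx wy|//]; first by rewrite Normc.normc0.
apply: le_trans (lerD zx wy); rewrite -lecR rmorphD.
exact: (ler_normD z w).
Qed.

(** Makes the supremum in [specnorm] a genuine upper bound. Entries of a unit vector have modulus at
    most 1, so each coordinate of the image is bounded by the sum of the moduli of a row. *)
Lemma vnorm_mulmx_bounded n (A : 'M[C]_n) : exists B : R,
  forall v : 'cV[C]_n, vnorm v = 1 -> vnorm (A *m v) <= B.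
Proof.
exists (Num.sqrt (\sum_i (\sum_j Normc.normc (A i j)) ^+ 2)) => v v1.
apply/ler_wsqrtr/ler_sum => i _.
rewrite ler_pXn2r ?nnegrE ?normc_ge0 ?sumr_ge0// => [|j _]; last exact: normc_ge0.
rewrite mxE; apply: le_trans (normc_sum _ _) _; apply: ler_sum => j _.
rewrite Normc.normcM ler_piMr ?normc_ge0//.
by rewrite -v1 entry_le_vnorm.
Qed.

(** The unit vector [delta_mx j 0] is mapped to column [j], whose norm dominates each of its
    entries. *)
Lemma entry_le_specnorm n (A : 'M[C]_n) i j :
  Normc.normc (A i j) <= specnorm A.
Proof.
have e1 : vnorm (delta_mx j 0 : 'cV[C]_n) = 1.
  rewrite /vnorm (bigD1 j)//= !mxE !eqxx Normc.normc1 expr1n big1 ?addr0 ?sqrtr1//.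
  by move=> k kj; rewrite !mxE (negbTE kj) Normc.normc0 expr0n.
apply: (@le_trans _ _ (vnorm (A *m delta_mx j 0))).
  by rewrite -colE; have := entry_le_vnorm (col j A) i; rewrite mxE.
have [B AB] := vnorm_mulmx_bounded A.
apply: ub_le_sup; last by exists (delta_mx j 0).
by exists B => _ [v v1 <-]; exact: AB.
Qed.

End SpectralNorm.

(** * Permutations of the tensor factors *)

Lemma qubitsE (i : 'I_(2 * 2 * 2)) : qubits i =
  [tuple (mxtens_unindex (mxtens_unindex i).1).1;
         (mxtens_unindex (mxtens_unindex i).1).2; (mxtens_unindex i).2].
Proof. by []. Qed.

Definition of_qubits (b : 3.-tuple 'I_2) : 'I_(2 * 2 * 2) :=
  mxtens_index (mxtens_index (tnth b 0, tnth b 1), tnth b 2%:R).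

Lemma qubitsK : cancel qubits of_qubits.
Proof.
by move=> i; apply: val_inj; rewrite /= -!divn_eq.
Qed.

Lemma of_qubitsK : cancel of_qubits qubits.
Proof.
move=> b; rewrite qubitsE !mxtens_indexK /=; apply: eq_from_tnth => k.
by case: k => [[|[|[|//]]] ?]; rewrite (tnth_nth ord0) /=; congr tnth; apply: val_inj.
Qed.

Lemma permute_qubits_subproof (s : 'S_3) :
  injective (fun i => of_qubits [tuple tnth (qubits i) ((s^-1)%g k) | k < 3]).
Proof.
move=> i j /(can_inj of_qubitsK) ij; apply: (can_inj qubitsK); apply: eq_from_tnth => k.
by have := congr1 (fun b => tnth b (s k)) ij; rewrite !tnth_mktuple permK.
Qed.

(** The permutation of basis indices whose matrix is [factor_perm s]. The inverse of [s] enters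
    because row [i] of a permutation matrix has its 1 in the column of the image of [i]. *)
Definition permute_qubits s : 'S_(2 * 2 * 2) := perm (@permute_qubits_subproof s).

Lemma tnth_permute_qubits s i k :
  tnth (qubits (permute_qubits s i)) k = tnth (qubits i) ((s^-1)%g k).
Proof. by rewrite permE of_qubitsK tnth_mktuple. Qed.

Section Tens3.
Variable K : comPzRingType.

(** Indexing the factors by ['I_3] and reading entries off the bits turns a permutation of tensor
    factors into a reindexing of a product. *)
Definition tens3 (a : 'I_3 -> 'M[K]_2) : 'M[K]_(2 * 2 * 2) :=
  \matrix_(i, j) \prod_k a k (tnth (qubits i) k) (tnth (qubits j) k).

Lemma tens3E (a : 'I_3 -> 'M[K]_2) : tens3 a = a 0 *t a 1 *t a 2%:R.
Proof.
apply/matrixP => i j; rewrite !mxE !big_ord_recl big_ord0 mulr1 mulrA.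
rewrite !(tnth_nth ord0) /=.
by congr (a _ _ _ * a _ _ _ * a _ _ _); exact: val_inj.
Qed.

Lemma tens3M (a b : 'I_3 -> 'M[K]_2) :
  tens3 a *m tens3 b = tens3 (fun k => a k *m b k).
Proof. by rewrite !tens3E !tensmx_mul. Qed.

Lemma tens3_1 : tens3 (fun=> 1%:M) = 1%:M.
Proof. by rewrite tens3E !tens11. Qed.

Lemma tens3_permute (a : 'I_3 -> 'M[K]_2) s i j :
  tens3 a (permute_qubits s i) (permute_qubits s j) = tens3 (fun k => a (s k)) i j.
Proof.
rewrite !mxE (reindex_inj (@perm_inj _ s)); apply: eq_bigr => k _.
by rewrite !tnth_permute_qubits permK.
Qed.

Lemma tens_trace m n (A : 'M[K]_m) (B : 'M[K]_n) : \tr (A *t B) = \tr A * \tr B.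
Proof. by rewrite /mxtrace mulr_sum; apply: eq_bigr => i _; rewrite mxE. Qed.

End Tens3.

Section PermutationMatrices.
Variable C : numClosedFieldType.

Lemma perm_mx_adj n (s : 'S_n) : (perm_mx s : 'M[C]_n)^t* = perm_mx s^-1.
Proof. by rewrite tr_perm_mx map_perm_mx. Qed.

Lemma perm_mx_unitary n (s : 'S_n) : (perm_mx s : 'M[C]_n) \is unitarymx.
Proof. by apply/unitarymxP; rewrite perm_mx_adj -perm_mxM mulgV perm_mx1. Qed.

Lemma perm_mx_conj n (s : 'S_n) (X : 'M[C]_n) i j :
  (perm_mx s *m X *m (perm_mx s)^t*) i j = X (s i) (s j).
Proof. by rewrite perm_mx_adj -row_permE -col_permE !mxE. Qed.

(** Two families of unitaries suffice: sign flips of one coordinate kill the off-diagonal entries,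
    and transpositions equate the diagonal ones. *)
Lemma scalar_of_unitary_comm n (M : 'M[C]_n) :
  (forall V, V \is unitarymx -> V *m M = M *m V) -> is_scalar_mx M.
Proof.
move=> VM.
have M0 i j : i != j -> M i j = 0.
  move=> ij; pose z k : C := if k == i then -1 else 1.
  have zu : dg z \is unitarymx.
    apply: dg_unitary => k; rewrite /z; case: ifP => _.
      by rewrite rmorphN1 mulrNN mulr1.
    by rewrite rmorph1 mulr1.
  have /matrixP/(_ i j) := VM _ zu.
  rewrite mul_diag_mx mul_mx_diag !mxE /z eqxx [j == i]eq_sym (negbTE ij).
  rewrite mulN1r mulr1 => /eqP; rewrite eq_sym -subr_eq0 opprK -mulr2n.
  by rewrite mulrn_eq0 => /eqP.
have MM i j : M i i = M j j.
  have /matrixP/(_ i j) := VM _ (perm_mx_unitary (tperm i j)).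
  rewrite -row_permE -[tperm i j in RHS]invgK -col_permE !mxE.
  by rewrite tpermV tpermL tpermR.
(* The scalar is read off at [M 0 0], which exists only for positive size; the empty matrix is
   treated apart. *)
case: n M VM M0 MM => [M _ _ _|n M _ M0 MM].
  by apply/is_scalar_mxP; exists 0; apply/matrixP => -[].
apply/is_scalar_mxP; exists (M 0 0); apply/matrixP => i j; rewrite mxE.
by case: eqVneq => [->|/M0//]; rewrite mulr1n.
Qed.

End PermutationMatrices.

Lemma factor_permE (R : realType) s :
  factor_perm R s = perm_mx (permute_qubits s).
Proof.
apply/matrixP => i j; rewrite !mxE; congr (nat_of_bool _)%:R.
apply/forallP/eqP => [sij|<- k]; last by rewrite tnth_permute_qubits permK.
apply: (can_inj qubitsK); apply: eq_from_tnth => k; rewrite tnth_permute_qubits.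
by rewrite (eqP (sij _)) permKV.
Qed.

(** Entries of the triple product are products of three entries of [m]: off the diagonal, a cube
    vanishes. On it, equal cubes would leave a cube root of unity undetermined, so a mixed product
    is compared as well. *)
Lemma tens3_scalar (K : fieldType) (m : 'M[K]_2) :
  is_scalar_mx (tens3 (fun=> m)) -> is_scalar_mx m.
Proof.
move=> /is_scalar_mxP[c]; rewrite tens3E => /matrixP mc.
have E (i0 i1 i2 j0 j1 j2 : 'I_2) : m i0 j0 * m i1 j1 * m i2 j2 =
    c *+ ((i0 == j0) && (i1 == j1) && (i2 == j2)).
  have := mc (mxtens_index (mxtens_index (i0, i1), i2))
    (mxtens_index (mxtens_index (j0, j1), j2)).
  rewrite !tensmxE => ->; rewrite mxE.
  by rewrite !(can_eq (@mxtens_indexK _ _)) !xpair_eqE (can_eq (@mxtens_indexK _ _)).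
have m0 i j : i != j -> m i j = 0.
  move=> ij; have := E i i i j j j.
  rewrite (negbTE ij) mulr0n => /eqP.
  by rewrite !mulf_eq0 !orbb => /eqP.
have mm : m 0 0 = m 1 1.
  have := E 0 0 0 0 0 0; have := E 0 0 1 0 0 1; have := E 1 1 1 1 1 1.
  rewrite !eqxx /= => <- E1 E0.
  (* If [m 0 0] is nonzero, cancel its square between $m_{00}^3$ and $m_{00}^2m_{11}$; otherwise
     $m_{11}^3=0$. *)
  have [m00|m00] := eqVneq (m 0 0) 0; last first.
    by apply: (mulfI (mulf_neq0 m00 m00)); rewrite E0 E1.
  move: E1; rewrite m00 !mul0r => /esym/eqP.
  by rewrite !mulf_eq0 !orbb => /eqP ->.
apply/is_scalar_mxP; exists (m 0 0); apply/matrixP => i j; rewrite mxE.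
case: eqVneq => [<-|/m0//]; rewrite mulr1n.
have [->//|i0] := eqVneq i 0; rewrite mm; congr (m _ _);
  by apply: val_inj; case: i i0 => [[|[]]].
Qed.

(** * The generators: a two-qubit Hamiltonian acting on two of three qubits *)

Section QubitHamiltonian.
Variable C : numClosedFieldType.

Definition qubit_hamiltonian (H : 'M[C]_(2 * 2)) (s : 'S_3) : 'M[C]_(2 * 2 * 2) :=
  perm_mx (permute_qubits s) *m (H *t 1%:M) *m (perm_mx (permute_qubits s))^t*.

Lemma qubit_hamiltonian_herm H s :
  H \is hermsymmx -> qubit_hamiltonian H s \is hermsymmx.
Proof. by move=> hH; apply/hermitian_conj/hermitian_tens/hermitian1. Qed.

Lemma trace_qubit_hamiltonian H s : \tr (qubit_hamiltonian H s) = \tr H * 2%:R.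
Proof.
have Pu := perm_mx_unitary C (permute_qubits s).
by rewrite mxtrace_mulC mulmxA (unitarymxPV Pu) mul1mx tens_trace mxtrace1.
Qed.

Lemma perm_mx_tens3 s (a : 'I_3 -> 'M[C]_2) :
  perm_mx (permute_qubits s) *m tens3 a *m (perm_mx (permute_qubits s))^t* =
  tens3 (fun k => a (s k)).
Proof. by apply/matrixP => i j; rewrite perm_mx_conj tens3_permute. Qed.

Lemma comm_unitary_conj n (P M X : 'M[C]_n) : P \is unitarymx ->
  P *m M *m P^t* = M -> X *m M = M *m X ->
  P *m X *m P^t* *m M = M *m (P *m X *m P^t*).
Proof.
move=> Pu PM XM; have PV := unitarymxPV Pu.
rewrite -[M in LHS]PM !mulmxA -[_ *m P^t* *m P]mulmxA PV mulmx1.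
rewrite -[M in RHS]PM -[_ *m P^t* *m P]mulmxA PV mulmx1.
by rewrite -[P *m X *m M]mulmxA XM mulmxA.
Qed.

(** Having equal factors, [tens3 (fun=> m)] is fixed by every permutation of the factors, which
    reduces the claim to [H *t 1%:M]. *)
Lemma qubit_hamiltonian_comm H s (m : 'M[C]_2) :
  H *m (m *t m) = (m *t m) *m H ->
  qubit_hamiltonian H s *m tens3 (fun=> m) =
  tens3 (fun=> m) *m qubit_hamiltonian H s.
Proof.
move=> Hm; apply: comm_unitary_conj.
- exact: perm_mx_unitary.
- by rewrite perm_mx_tens3.
- by rewrite tens3E !tensmx_mul Hm mulmx1 mul1mx.
Qed.

Lemma qubit_hamiltonianD G H s :
  qubit_hamiltonian (G + H) s = qubit_hamiltonian G s + qubit_hamiltonian H s.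
Proof.
rewrite /qubit_hamiltonian -mulmxDl -mulmxDr; congr (_ *m _ *m _).
by apply/matrixP => i j; rewrite !mxE mulrDl.
Qed.

Lemma qubit_hamiltonian_scalar (c : C) s :
  qubit_hamiltonian c%:M s = c%:M.
Proof.
have Pu := perm_mx_unitary C (permute_qubits s).
rewrite /qubit_hamiltonian -!dg_const tens_dg.
have -> : dg (fun _ : 'I_(2 * 2 * 2) => c * 1) = c%:M.
  by rewrite mulr1 dg_const.
by rewrite mul_mx_scalar -scalemxAl (unitarymxP Pu) scalemx1 dg_const.
Qed.

Lemma tens3_unitary (U : 'M[C]_2) :
  U \is unitarymx -> tens3 (fun=> U) \is unitarymx.
Proof. by move=> Uu; rewrite tens3E; do !apply: tens_unitary. Qed.

(** The triple product of [U] commutes with permutations of the factors, and its third factor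
    cancels on the identity. *)
Lemma qubit_hamiltonian_conj (A : 'M[C]_(2 * 2)) (U : 'M[C]_2) s :
  U \is unitarymx ->
  qubit_hamiltonian ((U *t U) *m A *m (U *t U)^t*) s =
  tens3 (fun=> U) *m qubit_hamiltonian A s *m (tens3 (fun=> U))^t*.
Proof.
move=> Uu; have /unitarymxP UK := Uu; rewrite /qubit_hamiltonian.
set P := perm_mx _; set W := tens3 _.
have Pu : P \is unitarymx by exact: perm_mx_unitary.
have PV := unitarymxPV Pu.
have PW : P *m W = W *m P.
  have {2}<- : P *m W *m P^t* = W := perm_mx_tens3 s (fun=> U).
  by rewrite -[_ *m P^t* *m P]mulmxA PV mulmx1.
have -> : (U *t U *m A *m (U *t U)^t*) *t 1%:M = W *m (A *t 1%:M) *m W^t*.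
  by rewrite /W tens3E !adjmx_tens !tensmx_mul mulmx1 UK.
have WP : W^t* *m P^t* = P^t* *m W^t* by rewrite -!adjmxM PW.
by rewrite !mulmxA PW -!mulmxA WP.
Qed.

(** Conjugation by a permutation matrix only relabels rows and columns simultaneously, which
    respects transposition. *)
Lemma qubit_hamiltonian_antisym (A : 'M[C]_(2 * 2)) s :
  A^T = - A -> (qubit_hamiltonian A s)^T = - qubit_hamiltonian A s.
Proof.
move=> /matrixP AT; apply/matrixP => i j; rewrite mxE [RHS]mxE !perm_mx_conj.
rewrite !mxE; have := AT (mxtens_unindex (permute_qubits s i)).1
  (mxtens_unindex (permute_qubits s j)).1.
by rewrite !mxE => ->; rewrite mulNr [(_ == _) in LHS]eq_sym.
Qed.

End QubitHamiltonian.

(** * From universality to entrywise approximation within an invariant set *)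

Section Universality.
Variable R : realType.
Local Notation C := R[i].

(** [G] is the invariant to be transported: it contains every approximating product, and the
    spectral norm of the error bounds each entry of it. *)
Lemma universal_zero (H : 'M[C]_(2 * 2)) (G : 'M[C]_(2 * 2 * 2) -> Prop) :
  three_universal H -> G 1%:M ->
  (forall X Y, G X -> G Y -> G (X *m Y)) ->
  (forall s t, G (exp_it t (qubit_hamiltonian H s))) ->
  forall V, V \is unitarymx -> forall e : C, 0 < e ->
  exists X, G X /\ forall i j, `|V i j - X i j| < e.
Proof.
move=> HU G1 GM Gexp V Vu [e e']; rewrite ltcE /= => /andP[/eqP -> e0].
have [l [Hs [t [HsP _ Ve]]]] := HU V e Vu e0.
exists (\prod_(j < l) expmx ((- 'i * (t j)%:C) *: Hs j)); split.
  elim/big_ind: _ => [|X Y|j _]; [exact: G1|exact: GM|].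
  have [s _ <-] := HsP j.
  by rewrite factor_permE; exact: Gexp.
move=> i j; rewrite -[`|_|]/((Normc.normc _)%:C) complexr0 ltcR.
apply: le_lt_trans Ve.
have := entry_le_specnorm (V - \prod_(j < l) expmx ((- 'i * (t j)%:C) *: Hs j)) i j.
by rewrite !mxE.
Qed.
End Universality.

(** * Invariants of the generated group *)

Lemma continuous_commutator (K : numFieldType) n (M : 'M[K]_n) i j :
  continuous (fun X : 'M[K]_n => (X *m M) i j - (M *m X) i j).
Proof.
apply: continuous_addr; last apply: continuous_oppr.
- by apply: continuous_mulmx => k l; [exact: coord_continuous|exact: cst_continuous].
- by apply: continuous_mulmx => k l; [exact: cst_continuous|exact: coord_continuous].
Qed.

(** Comparing two diagonal entries of $YY^T$, where $Y=PXQ$, eliminates the unknown scalar from the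
    condition that $YY^T$ be scalar. *)
Lemma continuous_gram_diff (K : numFieldType) n (P Q : 'M[K]_n) i j :
  continuous (fun X : 'M[K]_n =>
    ((P *m X *m Q) *m (P *m X *m Q)^T) i i - ((P *m X *m Q) *m (P *m X *m Q)^T) j j).
Proof.
have cY k l : continuous (fun X : 'M[K]_n => (P *m X *m Q) k l).
  apply: continuous_mulmx k l => k l; last exact: cst_continuous.
  by apply: continuous_mulmx k l => k l; [exact: cst_continuous|exact: coord_continuous].
have cG k l : continuous
    (fun X : 'M[K]_n => ((P *m X *m Q) *m (P *m X *m Q)^T) k l).
  apply: continuous_mulmx k l => k l; first exact: cY.
  by under eq_fun do rewrite mxE; exact: cY.
by apply: continuous_addr; last apply: continuous_oppr.
Qed.

Lemma continuous_minor (K : numFieldType) n (i j k l : 'I_n) :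
  continuous (fun X : 'M[K]_n => X i i * X j j - X k k * X l l).
Proof.
by apply: continuous_addr; last apply: continuous_oppr;
  apply: continuous_mulr; exact: coord_continuous.
Qed.

Lemma continuous_det_sub1 (K : numFieldType) n :
  continuous (fun X : 'M[K]_n => \det X - 1).
Proof. by apply: continuous_addr; [exact: continuous_det|exact: cst_continuous]. Qed.

Section PhaseRealOrthogonal.
Variable C : numClosedFieldType.

(* Satisfied by X = c W O W^* with O real and orthogonal. *)
Definition phase_real_orthogonal n (W X : 'M[C]_n) :=
  exists c : C, (W^t* *m X *m W) *m (W^t* *m X *m W)^T = c%:M.

Lemma phase_real_orthogonal1 n (W : 'M[C]_n) :
  W \is unitarymx -> phase_real_orthogonal W 1%:M.
Proof. by move=> Wu; exists 1; rewrite mulmx1 (unitarymxPV Wu) trmx1 mulmx1. Qed.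

(** Conjugation by [W] is multiplicative, and $(AB)(AB)^T=A(BB^T)A^T$ pulls out the scalar
    $BB^T$. *)
Lemma phase_real_orthogonalM n (W X Y : 'M[C]_n) : W \is unitarymx ->
  phase_real_orthogonal W X -> phase_real_orthogonal W Y ->
  phase_real_orthogonal W (X *m Y).
Proof.
move=> /unitarymxP WK [c Xc] [d Yd]; exists (d * c).
have -> : W^t* *m (X *m Y) *m W = (W^t* *m X *m W) *m (W^t* *m Y *m W).
  by rewrite !mulmxA -[_ *m W *m W^t*]mulmxA WK mulmx1.
rewrite trmx_mul; move: (W^t* *m X *m W) (W^t* *m Y *m W) Xc Yd => A B Ac Bd.
rewrite mulmxA -[A *m B *m B^T]mulmxA Bd.
by rewrite mul_mx_scalar -scalemxAl Ac scale_scalar_mx.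
Qed.

(** For a real unitary [O] the adjoint is the transpose, so $OO^T=1$ and only the square of the
    phase remains. *)
Lemma phase_real_orthogonalZ n (W O : 'M[C]_n) (c : C) : W \is unitarymx ->
  O \is unitarymx -> map_mx Num.conj O = O ->
  phase_real_orthogonal W (c *: (W *m O *m W^t*)).
Proof.
move=> Wu /unitarymxP OO Or; have WV := unitarymxPV Wu; exists (c * c).
have -> : W^t* *m (c *: (W *m O *m W^t*)) *m W = c *: O.
  rewrite -scalemxAr -scalemxAl; congr (_ *: _).
  by rewrite !mulmxA WV mul1mx -mulmxA WV mulmx1.
rewrite linearZ /= -scalemxAl -scalemxAr scalerA.
have -> : O *m O^T = 1%:M by rewrite -OO -map_trmx Or.
by rewrite scalemx1.
Qed.

End PhaseRealOrthogonal.

(** * Eigenvectors of Hermitian matrices and their rank-one projections *)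

Section HermitianEigenvector.
Variable C : numClosedFieldType.

Lemma adj_mul_eq0 n (v : 'cV[C]_n) : v^t* *m v = 0 -> v = 0.
Proof.
move=> /matrixP/(_ 0 0); rewrite !mxE => vv0.
apply/matrixP => i j; rewrite (ord1 j) mxE; apply/eqP; rewrite -normr_eq0 -sqrf_eq0.
apply/eqP; have := @psumr_eq0P C _ xpredT (fun k => `|v k 0| ^+ 2).
apply=> // [k _|]; first by rewrite exprn_ge0.
rewrite -[RHS]vv0; apply: eq_bigr => k _.
by rewrite !mxE normCK mulrC.
Qed.

Lemma hermitian_eigenvector_comm n (A : 'M[C]_n) (v : 'cV[C]_n) (c : C) :
  A \is hermsymmx -> A *m v = c *: v -> A *m (v *m v^t*) = (v *m v^t*) *m A.
Proof.
move=> /hermsymmxP AA Av; have [->|v0] := eqVneq v 0.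
  by rewrite mul0mx mulmx0 mul0mx.
have vA : v^t* *m A = Num.conj c *: v^t*.
  by rewrite -{1}AA -adjmxM Av linearZ /= map_mxZ.
(* Evaluating $v^*Av$ in two ways shows that the eigenvalue is real, as $v^*v\ne0$. *)
have cr : Num.conj c = c.
  have := congr1 (fun w => v^t* *m w) Av.
  rewrite mulmxA vA -scalemxAl -scalemxAr => /eqP.
  rewrite -subr_eq0 -scalerBl scaler_eq0 subr_eq0 => /orP[/eqP//|/eqP/adj_mul_eq0 vz].
  by rewrite vz eqxx in v0.
by rewrite mulmxA Av -mulmxA vA cr -scalemxAl -scalemxAr.
Qed.

(** A vanishing off-diagonal entry makes one coordinate zero, so the scalar, being also a diagonal
    entry, is zero; then all $|a_i|^2$ vanish. *)
Lemma outer_scalar_eq0 (a : 'cV[C]_2) : is_scalar_mx (a *m a^t*) -> a = 0.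
Proof.
move=> /is_scalar_mxP[c /matrixP ac].
have E i j : a i 0 * Num.conj (a j 0) = c *+ (i == j).
  by have := ac i j; rewrite !mxE big_ord_recl big_ord0 addr0 !mxE.
have c0 : c = 0.
  have /eqP := E 0 1; rewrite mulr0n mulf_eq0 conjC_eq0 => /orP[] /eqP a0.
  - by rewrite -[c]/(c *+ (0 == 0 :> 'I_2)) -E a0 mul0r.
  - by rewrite -[c]/(c *+ (1 == 1 :> 'I_2)) -E a0 conjC0 mulr0.
apply/matrixP => i j; rewrite (ord1 j) mxE; apply/eqP.
by have /eqP := E i i; rewrite c0 mul0rn mulf_eq0 conjC_eq0 orbb.
Qed.

Lemma eigenvalue_scalar n (c a : C) : eigenvalue (c%:M : 'M[C]_n) a -> a = c.
Proof.
move=> /eigenvalueP[v vc v0]; apply/eqP; rewrite -subr_eq0.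
have /eqP := vc; rewrite mul_mx_scalar eq_sym -subr_eq0 -scalerBl scaler_eq0.
by rewrite (negbTE v0) orbF.
Qed.

End HermitianEigenvector.

(** * Nonuniversality under each of the five conditions *)

Section Nonuniversality.
Variable R : realType.
Local Notation C := R[i].
Implicit Types H : 'M[C]_(2 * 2).

(** Shared by conditions (2) and (5): under universality, commutation with the triple product of [m]
    passes from the generators to all unitaries, one entry of the commutator at a time. *)
Lemma universal_comm_scalar H (m : 'M[C]_2) : H \is hermsymmx ->
  H *m (m *t m) = (m *t m) *m H -> three_universal H -> is_scalar_mx m.
Proof.
move=> hH Hm HU; apply: tens3_scalar.
pose M := tens3 (fun=> m).
apply: scalar_of_unitary_comm => V Vu; apply/matrixP => i j.
pose G (X : 'M[C]_(2 * 2 * 2)) := X *m M = M *m X.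
have VG : forall e : C, 0 < e -> exists X, G X /\ forall i j, `|V i j - X i j| < e.
  apply: (universal_zero HU) Vu.
  - by rewrite /G mul1mx mulmx1.
  - by move=> X Y XM YM; rewrite /G -mulmxA YM mulmxA XM mulmxA.
  - move=> s t; apply: exp_it_comm; first exact: qubit_hamiltonian_herm.
    exact: qubit_hamiltonian_comm.
apply/eqP; rewrite -subr_eq0; apply/eqP.
apply: (zero_at_limit (@continuous_commutator C _ M i j) _ VG).
by move=> X ->; rewrite subrr.
Qed.

Lemma product_eigenvector_nonuniversal H (a : 'cV[C]_2) : H \is hermsymmx ->
  eigenvector H (a *t a) -> ~ three_universal H.
Proof.
move=> hH [aa0 [c Hc]] HU.
have aE : (a *m a^t*) *t (a *m a^t*) = (a *t a) *m (a *t a)^t*.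
  by rewrite adjmx_tens tensmx_mul.
have Hm : H *m ((a *m a^t*) *t (a *m a^t*)) = (a *m a^t*) *t (a *m a^t*) *m H.
  by rewrite aE; exact: hermitian_eigenvector_comm hH Hc.
have a0 := outer_scalar_eq0 (universal_comm_scalar hH Hm HU).
by move: aa0; rewrite a0 tens0mx eqxx.
Qed.

(** The unreachable unitary for conditions (1) and (3): its determinant is $-1$, and it violates the
    diagonal relation for product matrices. *)
Definition flip0 n : 'M[C]_n := dg (fun j : 'I_n => if j == 0%N :> nat then -1 else 1).

Lemma flip0_unitary n : flip0 n \is unitarymx.
Proof.
apply: dg_unitary => j; case: ifP => _; last by rewrite rmorph1 mulr1.
by rewrite rmorphN1 mulrNN mulr1.
Qed.

Lemma neqN11 : (-1 : C) != 1.
Proof. by rewrite eqNr oner_eq0. Qed.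

Lemma traceless_nonuniversal H : H \is hermsymmx -> \tr H = 0 ->
  ~ three_universal H.
Proof.
move=> hH trH HU; pose G (X : 'M[C]_(2 * 2 * 2)) := \det X = 1.
have VG : forall e : C, 0 < e -> exists X, G X /\
    forall i j, `|flip0 (2 * 2 * 2) i j - X i j| < e.
  apply: (universal_zero HU) (flip0_unitary _).
  - exact: det1.
  - by move=> X Y X1 Y1; rewrite /G det_mulmx X1 Y1 mulr1.
  - move=> s t; apply: det_exp_it; first exact: qubit_hamiltonian_herm.
    by rewrite trace_qubit_hamiltonian trH mul0r.
have G0 X : G X -> \det X - 1 = 0 by move=> ->; rewrite subrr.
have := zero_at_limit (@continuous_det_sub1 C _) G0 VG.
rewrite det_dg big_ord_recl /= big1; last by [].
by rewrite mulr1 => /eqP; rewrite subr_eq0 (negbTE neqN11).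
Qed.

Lemma local_nonuniversal H : local_hamiltonian H -> ~ three_universal H.
Proof.
move=> [H1 [H2 [h1 h2 HE]]] HU.
pose G X := exists a : 'I_3 -> 'M[C]_2, X = tens3 a.
have VG : forall e : C, 0 < e -> exists X, G X /\
    forall i j, `|flip0 (2 * 2 * 2) i j - X i j| < e.
  apply: (universal_zero HU) (flip0_unitary _).
  - by exists (fun=> 1%:M); rewrite tens3_1.
  - by move=> X Y [a ->] [b ->]; exists (fun k => a k *m b k); rewrite tens3M.
  - move=> s t.
    have h0 : (0 : 'M[C]_2) \is hermsymmx.
      by apply/hermsymmxP; rewrite trmx0 map_mx0.
    have hl : H1 *t 1%:M + 1%:M *t H2 \is hermsymmx.
      apply/hermsymmxP; rewrite linearD /= map_mxD.
      by rewrite !adjmx_tens (hermsymmxP _ h1) (hermsymmxP _ h2) trmx1 map_mx1.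
    (* Adding the zero Hamiltonian on the third qubit lets [exp_it_tens] apply twice. *)
    have HE' : H *t 1%:M = (H1 *t 1%:M + 1%:M *t H2) *t 1%:M +
        (1%:M : 'M[C]_(2 * 2)) *t (0 : 'M[C]_2).
      by rewrite tensmx0 addr0 HE.
    rewrite /qubit_hamiltonian HE' (exp_it_conj _ _ (perm_mx_unitary _ _)).
    + rewrite !exp_it_tens//.
      pose a (k : 'I_3) :=
        nth 0 [:: exp_it t H1; exp_it t H2; exp_it t (0 : 'M_2)] k.
      exists (fun k => a (s k)); rewrite -[_ *t exp_it t 0](tens3E a).
      exact: perm_mx_tens3.
    + by rewrite -HE'; apply/hermitian_tens/hermitian1; rewrite HE.
pose ix (i j k : 'I_2) := mxtens_index (mxtens_index (i, j), k).
(* For a product matrix both terms contain the same diagonal entries of the three factors. *)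
have G0 X : G X -> X (ix 0 0 0) (ix 0 0 0) * X (ix 1 1 0) (ix 1 1 0) -
    X (ix 1 0 0) (ix 1 0 0) * X (ix 0 1 0) (ix 0 1 0) = 0.
  by move=> [a ->]; rewrite tens3E !tensmxE; ring.
have := zero_at_limit (@continuous_minor C _ _ _ _ _) G0 VG.
rewrite /flip0 !mxE !eqxx !mulr1n /= !mulr1 => /eqP.
by rewrite subr_eq0 (negbTE neqN11).
Qed.

Lemma antisymmetric_nonuniversal (r : R) (U : 'M[C]_2) (A : 'M[C]_(2 * 2)) :
  U \is unitarymx -> A \is hermsymmx -> A^T = - A ->
  ~ three_universal ((r%:C)%:M + (U *t U) *m A *m (U *t U)^t*).
Proof.
move=> Uu hA AT HU.
pose W := tens3 (fun=> U); have Wu : W \is unitarymx by exact: tens3_unitary.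
(* With one phase $i$ and the others 1, the square of [dg z] has diagonal entries $-1$ and 1, so it
   is not scalar. *)
pose z (j : 'I_(2 * 2 * 2)) : C := if j == 0%N :> nat then 'i else 1.
have zu : dg z \is unitarymx.
  apply: dg_unitary => j; rewrite /z; case: ifP => _; last by rewrite rmorph1 mulr1.
  have -> : Num.conj ('i : C) = - 'i by apply/eqP; rewrite eq_complex /= oppr0 !eqxx.
  by rewrite mulrN -expr2 sqr_i opprK.
have Vu : W *m dg z *m W^t* \is unitarymx.
  exact: unitary_mxconj Wu zu.
have VG : forall e : C, 0 < e -> exists X, phase_real_orthogonal W X /\
    forall i j, `|(W *m dg z *m W^t*) i j - X i j| < e.
  apply: (universal_zero HU) Vu.
  - exact: phase_real_orthogonal1 Wu.
  - by move=> X Y; exact: phase_real_orthogonalM Wu.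
  - move=> s t; pose K := qubit_hamiltonian A s.
    have hK : K \is hermsymmx by exact: qubit_hamiltonian_herm.
    (* The generator is $r+WKW^*$ with $K$ antisymmetric, so its exponential is a phase times a real
       orthogonal matrix conjugated by $W$. *)
    rewrite qubit_hamiltonianD qubit_hamiltonian_scalar.
    rewrite (qubit_hamiltonian_conj _ _ Uu).
    rewrite (exp_it_shift _ _ (hermitian_conj _ hK)) (exp_it_conj _ hK Wu).
    apply: (phase_real_orthogonalZ _ Wu); first exact: exp_it_unitary.
    exact: exp_it_antisymmetric (qubit_hamiltonian_antisym _ AT).
have G0 X : phase_real_orthogonal W X ->
    ((W^t* *m X *m W) *m (W^t* *m X *m W)^T) ord0 ord0 -
    ((W^t* *m X *m W) *m (W^t* *m X *m W)^T) ord_max ord_max = 0.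
  by move=> [c ->]; rewrite !mxE !eqxx subrr.
have := zero_at_limit (@continuous_gram_diff C _ _ _ _ _) G0 VG.
have -> : W^t* *m (W *m dg z *m W^t*) *m W = dg z.
  have WV := unitarymxPV Wu.
  by rewrite !mulmxA WV mul1mx -mulmxA WV mulmx1.
rewrite tr_dg dgM !mxE !eqxx !mulr1n /z /= mulr1.
have -> : 'i * 'i = -1 :> C by rewrite -expr2 sqr_i.
by move=> /eqP; rewrite subr_eq0 (negbTE neqN11).
Qed.

End Nonuniversality.

Theorem lemma9 (R : realType) (H : 'M[R[i]]_(2 * 2)) :
  H \is hermsymmx ->
  local_hamiltonian H
  \/ (exists a : 'cV[R[i]]_2, eigenvector H (a *t a))
  \/ \tr H = 0
  \/ (exists (r : R) (U : 'M[R[i]]_2) (A : 'M[R[i]]_(2 * 2)),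
        [/\ U \is unitarymx, A \is hermsymmx, A^T = - A
          & H = (r%:C)%:M + (U *t U) *m A *m (U *t U)^t*])
  \/ (exists U : 'M[R[i]]_2,
        [/\ U \is unitarymx, distinct_eigenvalues U
          & H *m (U *t U) - (U *t U) *m H = 0]) ->
  ~ three_universal H.
Proof.
move=> hH [|[[a]|[|[[r [U [A [Uu hA AT ->]]]]|[U [_ [x [y [xy Ux Uy]]] HUU]]]]]].
- exact: local_nonuniversal.
- exact: product_eigenvector_nonuniversal.
- exact: traceless_nonuniversal.
- exact: antisymmetric_nonuniversal.
(* Universality would make [U] scalar, and a scalar matrix has only one eigenvalue. *)
- move=> /(universal_comm_scalar hH (subr0_eq HUU))/is_scalar_mxP[c Uc].
  move: xy Ux Uy; rewrite Uc => xy /eigenvalue_scalar xc /eigenvalue_scalar yc.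
  by rewrite xc yc eqxx in xy.
Qed.
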